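(* Let $n>s>0$ be integers, let $X$ be an $n$-element set, and let $\mathscr{A},\mathscr{B}\subset 2^X$ be nonempty antichains that are cross $s$-union. Then there exist antichains $\tilde{\mathscr{A}},\tilde{\mathscr{B}}\subset 2^X$ (nonempty, so that $t(\tilde{\mathscr{A}})$ and $t(\tilde{\mathscr{B}})$ are defined) such that (i) $|\mathscr{A}|\le|\tilde{\mathscr{A}}|$ and $|\mathscr{B}|\le|\tilde{\mathscr{B}}|$; (ii) $t(\tilde{\mathscr{A}})\le t(\mathscr{A})$ and $t(\tilde{\mathscr{B}})\le t(\mathscr{B})$; and (iii) $t(\tilde{\mathscr{A}})+t(\tilde{\mathscr{B}})\le s$. Moreover, unless both $\mathscr{A}=\binom{X}{t(\mathscr{A})}$ and $\mathscr{B}=\binom{X}{t(\mathscr{B})}$ hold, the antichains $\tilde{\mathscr{A}},\tilde{\mathscr{B}}$ satisfying (i)-(iii) can be chosen so that in addition (iv) $|\mathscr{A}|+|\mathscr{B}|<|\tilde{\mathscr{A}}|+|\tilde{\mathscr{B}}|$.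
   Context: $2^X$ is the power set of $X$ and $\binom{X}{i}$ is the family of all $i$-element subsets of $X$. A family $\mathscr{F}\subset 2^X$ is an antichain if $F\subset F'$ never holds for distinct $F,F'\in\mathscr{F}$. Families $\mathscr{A},\mathscr{B}\subset 2^X$ are cross $s$-union if $|A\cup B|\le s$ for all $A\in\mathscr{A}$, $B\in\mathscr{B}$. For a nonempty family $\mathscr{F}\subset 2^X$, $t(\mathscr{F})=\max\{|F|:F\in\mathscr{F}\}$. *)

(* Defs.v *)
From mathcomp Require Import all_boot.

Set Implicit Arguments.
Unset Strict Implicit.
Unset Printing Implicit Defensive.

Section Families.

Variable X : finType.
Implicit Types FF AA BB : {set {set X}}.

Definition antichain FF : Prop :=
  forall F F', F \in FF -> F' \in FF -> F != F' -> ~~ (F \subset F').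

Definition cross_union (s : nat) AA BB : Prop :=
  forall A B, A \in AA -> B \in BB -> #|A :|: B| <= s.

Definition layer (i : nat) : {set {set X}} := [set F : {set X} | #|F| == i].

(* The maximum over an empty family is 0 by convention, so [tmax FF] is only
   meaningful together with [FF != set0]. *)
Definition tmax FF : nat := \max_(F in FF) #|F|.

Definition dominating_pair (s : nat) AA BB AA' BB' : Prop :=
  [/\ AA' != set0 /\ BB' != set0,
      antichain AA' /\ antichain BB',
      #|AA| <= #|AA'| /\ #|BB| <= #|BB'|,
      tmax AA' <= tmax AA /\ tmax BB' <= tmax BB
    & tmax AA' + tmax BB' <= s].

End Families.

Arguments layer X i : clear implicits.

(* Main.v *)
Require Import Defs.
From mathcomp Require Import all_boot perm zify.

Set Implicit Arguments.
Unset Strict Implicit.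
Unset Printing Implicit Defensive.

(** Write a and b for the largest sizes of members of AA and BB.

    If a + b <= s, only Sperner-type growth is at stake: an antichain which is
    not the full layer of its largest size a can be replaced by a strictly
    larger antichain whose members still have size at most a
    ([larger_antichain]).  A uniform family is replaced by its full layer;
    otherwise the lowest level, if it lies below the middle, is replaced by its
    upper shadow, and if it does not, the highest level lies well above the
    middle and is replaced by its shadow.  Both replacements gain by double
    counting.

    If a + b > s, two disjoint sets from the top levels of AA and BB would have
    a union of size a + b, so the two top levels are cross-intersecting.  The
    heart of the proof is that of two cross-intersecting families at least one
    is no larger than its shadow ([cross_intersecting_shadow]).  Replacing that
    top level by its shadow keeps the antichain and the cross s-union property,
    loses no cardinality and lowers a + b, so induction on a + b applies.
    Strictness could be lost only if the modified pair consists of two full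
    layers; but then the family that was left alone, say BB, is the layer of
    all b-sets, and since s < n one of them together with an a-set of AA covers
    more than s points.

    The shadow inequality is proved by shifting.  Shifts keep cardinalities and
    the cross-intersecting property and do not enlarge shadows, so both
    families may be assumed stable under replacing an element by a smaller
    one.  Call a set a ballot set if it fills at most half of every initial
    segment.  Two ballot sets of shifted families can be moved apart until they
    are disjoint ([ballot_not_cross_intersecting]), so one of the families has
    no ballot set.  Reading a set as a walk, up at its elements and down
    elsewhere, a set that is not ballot has a walk rising above its starting
    height; deleting the element by which the walk first reaches its maximum is
    an injection into the shadow, because in the image that position is the
    last maximum of the walk ([card_shadow_not_ballot]). *)

(** * Shadows and shifting *)

Section Shifting.

Variable X : finType.
Implicit Types (F G A B : {set X}) (FF AA BB : {set {set X}}).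

Definition cross_intersecting AA BB : Prop :=
  forall A B, A \in AA -> B \in BB -> ~~ [disjoint A & B].

Definition shadow FF : {set {set X}} :=
  [set G : {set X} | [exists x, (x \notin G) && (x |: G \in FF)]].

Lemma shadowP FF G :
  reflect (exists2 x, x \notin G & x |: G \in FF) (G \in shadow FF).
Proof.
rewrite inE; apply: (iffP existsP) => [[x /andP[]]|[x xG xF]]; exists x => //.
by rewrite xG.
Qed.

Lemma mem_shadow FF F x : F \in FF -> x \in F -> F :\ x \in shadow FF.
Proof. by move=> FFF xF; apply/shadowP; exists x; rewrite ?setD1K// !inE eqxx. Qed.

(** A preimage rather than an image, so that membership computes; [tperm] is an
    involution, hence nothing is lost. *)
Definition swap (i j : X) F : {set X} := tperm i j @^-1: F.

Lemma in_swap i j F x : (x \in swap i j F) = (tperm i j x \in F).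
Proof. by rewrite inE. Qed.

Lemma swapK i j : involutive (swap i j).
Proof. by move=> F; apply/setP=> x; rewrite !in_swap tpermK. Qed.

Lemma swap_id i j F : (i \in F) = (j \in F) -> swap i j F = F.
Proof.
by move=> ijF; apply/setP=> x; rewrite in_swap; case: tpermP => // ->.
Qed.

Lemma swap_setU1 i j F x : swap i j (x |: F) = tperm i j x |: swap i j F.
Proof.
apply/setP=> y; rewrite !(in_swap, inE); congr (_ || _).
by apply/eqP/eqP => [<-|->]; rewrite tpermK.
Qed.

Lemma swap_replace i j F : i \notin F -> j \in F -> swap i j F = i |: (F :\ j).
Proof.
move=> iF jF; apply/setP=> x; rewrite in_swap !inE.
case: tpermP => [->|->|/eqP/negPf-> /eqP/negPf->] //=; first by rewrite eqxx.
by rewrite eqxx (negPf iF) /=; case: eqP iF jF => // -> /negPf->.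
Qed.

(** The sets which the shift replacing j by i really moves: those for which the
    result is not already present. *)
Definition moves i j FF F : bool :=
  [&& j \in F, i \notin F & swap i j F \notin FF].

Definition shift i j FF : {set {set X}} :=
  [set if moves i j FF F then swap i j F else F | F in FF].

Lemma shift_inj i j FF :
  {in FF &, injective (fun F => if moves i j FF F then swap i j F else F)}.
Proof.
move=> F F' FFF FFF'; case: ifP => mF; case: ifP => mF' //.
- exact: (can_inj (@swapK i j)).
- by move=> e; case/and3P: mF => _ _; rewrite e FFF'.
- by move=> e; case/and3P: mF' => _ _; rewrite -e FFF.
Qed.

Lemma card_shift i j FF : #|shift i j FF| = #|FF|.
Proof. exact: card_in_imset (@shift_inj i j FF). Qed.

(** Seen on the pairs formed by a set and its swap, a shift keeps both sets or
    none, and of exactly one keeps the one containing i.  Membership in this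
    form makes the two preservation results below a matter of cases. *)
Lemma in_shift i j FF F :
  (F \in shift i j FF) =
    (F \in FF) && [|| j \notin F, i \in F | swap i j F \in FF] ||
    [&& i \in F, j \notin F & swap i j F \in FF].
Proof.
apply/imsetP/idP => [[G GFF ->]|].
  case: ifPn => [/and3P[jG iG _]|].
    by apply/orP; right; rewrite !in_swap tpermL tpermR jG iG swapK.
  by rewrite !negb_and !negbK => ->; rewrite GFF.
have [FFF /=|FFF /= /and3P[iF jF sF]] := boolP (F \in FF).
  case/orP=> [hF|/and3P[iF jF _]].
    exists F => //; case: ifPn => // /and3P[jF iF sF]; move: hF.
    by rewrite jF (negPf iF) (negPf sF).
  by exists F => //; rewrite /moves (negPf jF).
exists (swap i j F) => //; rewrite /moves !in_swap tpermL tpermR iF jF swapK.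
by rewrite FFF.
Qed.

Lemma in_shift_or i j FF F :
  F \in shift i j FF -> F \in FF \/ swap i j F \in FF.
Proof.
by rewrite in_shift => /orP[/andP[-> _]|/and3P[_ _ ->]]; [left|right].
Qed.

(** Splitting on which of i and j belong to G: the only case with two memberships
    to establish is j in G and i not in G.  Either x |: G shares this
    pattern, and then FF contains it together with its swap, or x = i, and then
    removing i or j from x |: G gives G and its swap. *)
Lemma shadow_shift i j FF : shadow (shift i j FF) \subset shift i j (shadow FF).
Proof.
apply/subsetP=> G /shadowP[x xG xS].
(* Every set of the shifted family or its swap comes from FF; each possibility
   puts G or its swap into the shadow of FF. *)
have up : x |: G \in FF -> G \in shadow FF by move=> ?; apply/shadowP; exists x.
have sw : swap i j (x |: G) \in FF -> swap i j G \in shadow FF.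
  rewrite swap_setU1 => ?; apply/shadowP; exists (tperm i j x) => //.
  by rewrite in_swap tpermK.
have [iG|iG] := boolP (i \in G); have [jG|jG] := boolP (j \in G); rewrite in_shift.
- rewrite iG jG orbF andbT; apply: up; case: (in_shift_or xS) => //.
  by rewrite swap_id // !inE iG jG !orbT.
- rewrite iG jG /= andbT; case: (in_shift_or xS) => [/up->|/sw->] //; exact: orbT.
- rewrite jG (negPf iG) /= orbF; have [xi|xi] := eqVneq x i.
    have xF : x |: G \in FF.
      by case: (in_shift_or xS) => //; rewrite swap_id // !inE xi eqxx jG orbT.
    rewrite up //=; apply/shadowP; exists j.
      by rewrite in_swap tpermR.
    rewrite swap_replace // setUCA setD1K //.
    by rewrite -xi.
  have jx : j \in x |: G by rewrite !inE jG orbT.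
  have ix : i \notin x |: G by rewrite !inE negb_or eq_sym xi.
  by move: xS; rewrite in_shift jx (negPf ix) /= orbF => /andP[/up-> /sw->].
- rewrite jG (negPf iG) /= orbF andbT; case: (in_shift_or xS) => // sF.
  have [xi|xi] := eqVneq x i.
    apply/shadowP; exists j => //.
    by move: sF; rewrite swap_setU1 xi tpermL swap_id // (negPf iG) (negPf jG).
  have [xj|xj] := eqVneq x j; last first.
    by apply: up; move: sF; rewrite swap_id // !inE (negPf iG) (negPf jG) !(eq_sym _ x)
      (negPf xi) (negPf xj).
  have jx : j \in x |: G by rewrite !inE xj eqxx.
  have ix : i \notin x |: G by rewrite !inE negb_or eq_sym xi.
  by apply: up; move: xS; rewrite in_shift jx (negPf ix) /= orbF => /andP[].
Qed.

Lemma card_shadow_shift i j FF : #|shadow (shift i j FF)| <= #|shadow FF|.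
Proof. by rewrite -(card_shift i j (shadow FF)) subset_leq_card ?shadow_shift. Qed.

Lemma disjoint_swap i j A B :
  [disjoint swap i j A & swap i j B] = [disjoint A & B].
Proof.
rewrite -!setI_eq0 -preimsetI.
apply/eqP/eqP => [/setP e|->]; apply/setP=> x; rewrite ?inE //.
by move: (e (tperm i j x)); rewrite !inE tpermK.
Qed.

(** Disjoint members of the shifted families would have to come from opposite
    sides: one unmoved, the other a genuine result of the shift, hence
    containing i but not j.  The unmoved set then misses i, so its swap is
    present too, and swapping both sets gives a disjoint pair before the
    shift. *)
Lemma shift_cross_intersecting i j AA BB :
  cross_intersecting AA BB ->
  cross_intersecting (shift i j AA) (shift i j BB).
Proof.
have main AA' BB' A B : cross_intersecting AA' BB' -> A \in shift i j AA' ->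
    A \in AA' -> B \in shift i j BB' -> ~~ [disjoint A & B].
  move=> cr sA A' sB; have [B'|B'] := boolP (B \in BB'); first exact: cr.
  move: sB; rewrite in_shift (negPf B') /= => /and3P[iB jB sB].
  apply/negP=> dAB.
  have iA : i \notin A by rewrite (disjointFl dAB iB).
  suff sA' : swap i j A \in AA' by move: (cr _ _ sA' sB); rewrite disjoint_swap dAB.
  have [jA|jA] := boolP (j \in A).
    by move: sA; rewrite in_shift jA (negPf iA) /= orbF => /andP[].
  by rewrite swap_id // (negPf iA) (negPf jA).
move=> cr A B sA sB.
have [A'|A'] := boolP (A \in AA); first exact: (main AA BB).
have [B'|B'] := boolP (B \in BB).
  rewrite disjoint_sym; apply: (main BB AA) => // B0 A0 ? ?.
  by rewrite disjoint_sym cr.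
case: (in_shift_or sA) => [|sA']; first by rewrite (negPf A').
case: (in_shift_or sB) => [|sB']; first by rewrite (negPf B').
by rewrite -(disjoint_swap i j) cr.
Qed.

Definition rank (x : X) : nat := enum_rank x.

Lemma rank_inj : injective rank.
Proof. by move=> x y /ord_inj/enum_rank_inj. Qed.

Lemma rank_lt x : rank x < #|X|.
Proof. exact: ltn_ord. Qed.

Definition weight FF : nat := \sum_(F in FF) \sum_(x in F) rank x.

Lemma sum_rank_swap i j F : rank i < rank j -> i \notin F -> j \in F ->
  \sum_(x in swap i j F) rank x < \sum_(x in F) rank x.
Proof.
move=> ij iF jF; rewrite swap_replace // big_setU1 ?inE ?negb_and ?iF ?orbT //=.
by rewrite [ltnRHS](big_setD1 j) //= ltn_add2r.
Qed.

(** The equality case is what makes the repeated shifting of both families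
    terminate at shifted ones. *)
Lemma weight_shift i j FF : rank i < rank j ->
  weight (shift i j FF) <= weight FF ?= iff ~~ [exists F in FF, moves i j FF F].
Proof.
move=> ij; rewrite /weight big_imset /=; last exact: shift_inj.
have -> : ~~ [exists F in FF, moves i j FF F] =
          [forall (F | F \in FF), ~~ moves i j FF F].
  rewrite negb_exists; apply: eq_forallb => F.
  by rewrite negb_and implybE.
apply: leqif_sum => F _; case: ifPn => [/and3P[jF iF _]|_]; last exact/leqif_refl.
by have h := sum_rank_swap ij iF jF; split; [exact: ltnW | rewrite ltn_eqF].
Qed.

Definition shifted FF : Prop :=
  forall i j F, rank i < rank j -> F \in FF -> i \notin F -> j \in F ->
    i |: (F :\ j) \in FF.

Lemma not_moves_shifted FF :
  (forall i j, rank i < rank j -> ~~ [exists F in FF, moves i j FF F]) ->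
  shifted FF.
Proof.
move=> h i j F ij FFF iF jF; apply/negPn/negP=> nF.
case/negP: (h i j ij); apply/existsP; exists F.
by rewrite FFF /moves jF iF swap_replace.
Qed.

End Shifting.

(** * Ballot sets of shifted families *)

Section Ballot.

Variable X : finType.
Implicit Types (F A B : {set X}) (FF AA BB : {set {set X}}).

Definition prefix k : {set X} := [set x | rank x < k].

Lemma in_prefix k x : (x \in prefix k) = (rank x < k).
Proof. by rewrite inE. Qed.

Lemma card_setI_replace F (P : {set X}) i j : i \notin F -> j \in F ->
  #|(i |: (F :\ j)) :&: P| + (j \in P) = #|F :&: P| + (i \in P).
Proof.
have cI G : #|G :&: P| = \sum_(x in G) (x \in P).
  by rewrite -sum1_card -big_mkcondr; apply: eq_bigl => x; rewrite inE.
move=> iF jF; rewrite !cI big_setU1 ?inE ?negb_and ?iF ?orbT //=.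
by rewrite [in RHS](big_setD1 j) //=; lia.
Qed.

(** Take the smallest common element j of A and B.  The prefix ending at j counts
    j twice, so by the hypothesis it contains a point i in neither set.
    Replacing j by i in A stays in the shifted family, shrinks the
    intersection, and preserves the hypothesis: only prefixes containing i but
    not j gain a point, and these had room, as A and B were disjoint on them
    and both missed i. *)
Lemma shifted_disjoint AA BB A B :
  shifted AA -> A \in AA -> B \in BB ->
  (forall k, #|A :&: prefix k| + #|B :&: prefix k| <= #|prefix k|) ->
  ~ cross_intersecting AA BB.
Proof.
move=> shA AAA BBB hk cr.
have [m] := ubnP #|A :&: B|; elim: m A AAA hk => // m IH A AAA hk cAB.
have := cr A B AAA BBB; rewrite -setI_eq0 => /set0Pn[j0 j0AB].
case: (arg_minnP (@rank X) j0AB) => j jAB jmin.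
have {}jAB : j \in A :&: B := jAB.
have /setIP[jA jB] := jAB.
have cUI k : #|A :&: prefix k| + #|B :&: prefix k| =
    #|(A :|: B) :&: prefix k| + #|(A :&: B) :&: prefix k|.
  by rewrite -cardsUI setIUl setIACA setIid.
have [i iP iAB] : exists2 i, i \in prefix (rank j).+1 & i \notin A :|: B.
  apply/subsetPn/negP=> /setIidPr sP; move: (hk (rank j).+1).
  rewrite cUI sP leqNgt => /negP[]; rewrite -[ltnLHS]addn0 ltn_add2l card_gt0.
  by apply/set0Pn; exists j; rewrite in_setI jAB in_prefix ltnSn.
move: iAB; rewrite inE negb_or => /andP[iA iB].
have ij : rank i < rank j.
  rewrite in_prefix ltnS in iP; rewrite ltn_neqAle iP andbT.
  by apply/eqP=> /rank_inj e; rewrite e jA in iA.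
apply: (IH (i |: (A :\ j))); first exact: shA.
- move=> k; have := card_setI_replace (prefix k) iA jA; rewrite !in_prefix.
  have := hk k; have [kj|jk] := leqP k (rank j); last by lia.
  have [ik|ki] := ltnP (rank i) k; last by lia.
  have AB0 : #|(A :&: B) :&: prefix k| = 0.
    apply/eqP; rewrite cards_eq0; apply/eqP/setP=> x; rewrite !(inE, in_prefix).
    apply/negP=> /andP[xAB xk]; have xI : x \in A :&: B by rewrite inE.
    by have := leq_trans kj (jmin x xI); rewrite leqNgt xk.
  have : #|(A :|: B) :&: prefix k| < #|prefix k|.
    apply/proper_card/properP; split; first exact: subsetIr.
    by exists i; rewrite ?in_prefix // !inE (negPf iA) (negPf iB).
  have := cUI k; lia.
- have -> : (i |: (A :\ j)) :&: B = (A :&: B) :\ j.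
    apply/setP=> x; rewrite !inE; have [->|] := eqVneq x i; last by rewrite andbA.
    by rewrite (negPf iB) !andbF.
  by move: cAB; rewrite (cardsD1 j) jAB.
Qed.

Definition ballot F : bool :=
  [forall k : 'I_#|X|.+1, 2 * #|F :&: prefix k| <= #|prefix k|].

Lemma ballotP F k : ballot F -> 2 * #|F :&: prefix k| <= #|prefix k|.
Proof.
have -> : prefix k = prefix (minn k #|X|).
  apply/setP=> x; rewrite !in_prefix; have := rank_lt x; lia.
have h : minn k #|X| < #|X|.+1 by lia.
by move=> /forallP/(_ (Ordinal h)).
Qed.

Lemma ballot_not_cross_intersecting AA BB A B :
  shifted AA -> A \in AA -> B \in BB -> ballot A -> ballot B ->
  ~ cross_intersecting AA BB.
Proof.
move=> shA AAA BBB bA bB; apply: (shifted_disjoint shA AAA BBB) => k.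
by have := ballotP k bA; have := ballotP k bB; lia.
Qed.

(** Up to a constant, the height after k steps of the walk that goes up at the
    elements of F and down at the other points; the constant is chosen so that
    the value is a natural number. *)
Definition height F k : nat := 2 * #|F :&: prefix k| + #|~: prefix k|.

Lemma height0 F : height F 0 = #|X|.
Proof.
rewrite /height.
have -> : prefix 0 = set0 by apply/setP=> x; rewrite in_prefix.
by rewrite setI0 setC0 cards0 cardsT.
Qed.

Lemma heightS F x :
  (height F (rank x).+1).+1 = height F (rank x) + 2 * (x \in F).
Proof.
have xP : x \notin prefix (rank x) by rewrite in_prefix ltnn.
have eP : prefix (rank x).+1 = x |: prefix (rank x).
  apply/setP=> y; rewrite !(inE, in_prefix) ltnS leq_eqVlt.
  by rewrite (inj_eq (@rank_inj X)).
have := cardsC (prefix (rank x).+1); have := cardsC (prefix (rank x)).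
rewrite /height eP cardsU1 xP setIUr.
have -> : #|F :&: [set x] :|: F :&: prefix (rank x)| =
    (x \in F) + #|F :&: prefix (rank x)|.
  have [xF|xF] := boolP (x \in F).
    by rewrite (setIidPr _) ?sub1set // cardsU1 inE (negPf xP) andbF.
  rewrite (_ : F :&: [set x] = set0) ?set0U //.
  by apply/setP=> y; rewrite !inE; case: eqP => [->|]; rewrite ?andbF ?(negPf xF).
lia.
Qed.

Lemma height_D1 F x k : x \in F ->
  height F k = height (F :\ x) k + 2 * (rank x < k).
Proof.
move=> xF; rewrite /height -in_prefix.
suff -> : #|F :&: prefix k| = (x \in prefix k) + #|(F :\ x) :&: prefix k| by lia.
by rewrite (cardsD1 x) inE xF setIDAC.
Qed.

(** The walk of F reaches its maximum for the first time by the step x. *)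
Definition first_peak F x : bool :=
  [&& x \in F,
      [forall k : 'I_#|X|.+1, height F k <= height F (rank x).+1] &
      [forall k : 'I_#|X|.+1,
         (k <= rank x) ==> (height F k < height F (rank x).+1)]].

(** A walk exceeding its starting height attains its maximum after at least one
    step, and the step leading to the first maximum goes up. *)
Lemma not_ballot_first_peak F : ~~ ballot F -> exists x, first_peak F x.
Proof.
case/forallPn=> k0; rewrite -ltnNge => hk0.
case: (@arg_maxnP _ ord0 predT (fun k : 'I_#|X|.+1 => height F k)) => //= k1 _ kmax.
have hk1 : #|X| < height F k1.
  apply: leq_trans (kmax k0 isT); rewrite -[ltnLHS](cardsC (prefix k0)) /height.
  by rewrite ltn_add2r.
have ex : exists k, (k <= #|X|) && (height F k == height F k1).
  by exists k1; rewrite eqxx -ltnS ltn_ord.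
case: (ex_minnP ex) => -[|k] /andP[kX /eqP hk] kmin.
  by rewrite height0 in hk; lia.
pose x : X := enum_val (Ordinal kX).
have rx : rank x = k by rewrite /rank enum_valK.
have lt_k m : m <= k -> height F m < height F k1.
  move=> mk; have mX : m < #|X|.+1 by lia.
  rewrite ltn_neqAle (kmax (Ordinal mX) isT) andbT; apply/eqP=> e.
  have := kmin m; rewrite e eqxx; lia.
exists x; apply/and3P; split.
- apply/negPn/negP=> xF; have := heightS F x; rewrite rx hk (negPf xF).
  have := lt_k k (leqnn _); lia.
- by apply/forallP=> m; rewrite rx hk; apply: kmax.
- by apply/forallP=> m; rewrite rx hk; apply/implyP; apply: lt_k.
Qed.

(** Without x the walk of F has its last maximum just before x, which determines
    x from F :\ x.  Were x smaller than y, comparing the common walk of F :\ x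
    and F' :\ y at the positions of x and y would give a strict inequality from
    F and the opposite one from F'. *)
Lemma first_peak_inj F F' x y :
  first_peak F x -> first_peak F' y -> F :\ x = F' :\ y -> F = F'.
Proof.
wlog le_xy : F F' x y / rank x <= rank y.
  move=> W px py e; have [le|le] := leqP (rank x) (rank y); first exact: W e.
  by apply/esym/(W _ _ y x) => //; exact: ltnW.
move=> /and3P[xF /forallP maxF _] /and3P[yF' _ /forallP minF'] e.
have [xy|ne_xy] := eqVneq x y.
  by rewrite -(setD1K xF) e xy setD1K.
have lt_xy : rank x < rank y.
  by rewrite ltn_neqAle le_xy andbT; apply: contra_neq ne_xy => /rank_inj.
have yX : rank y < #|X|.+1 by have := rank_lt y; lia.
have xX : rank x < #|X|.+1 by apply: ltn_trans lt_xy yX.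
have := maxF (Ordinal yX); have /implyP/(_ le_xy) := minF' (Ordinal xX).
have := heightS F x; have := heightS F' y; rewrite /= xF yF'.
rewrite !(height_D1 _ xF) !(height_D1 _ yF') -e; lia.
Qed.

Lemma card_shadow_not_ballot FF :
  (forall F, F \in FF -> ~~ ballot F) -> #|FF| <= #|shadow FF|.
Proof.
move=> nb; pose f F := if [pick x | first_peak F x] is Some x then F :\ x else F.
have fP F : F \in FF -> exists2 x, first_peak F x & f F = F :\ x.
  move=> /nb/not_ballot_first_peak[x0 px0]; rewrite /f.
  by case: pickP => [x px|/(_ x0)]; [exists x | rewrite px0].
have f_inj : {in FF &, injective f}.
  move=> F F' /fP[x px ->] /fP[y py ->]; exact: first_peak_inj.
rewrite -(card_in_imset f_inj); apply/subset_leq_card/subsetP=> _ /imsetP[F FFF ->].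
by have [x /and3P[xF _ _] ->] := fP F FFF; apply: mem_shadow.
Qed.

(** A form of Katona's intersecting shadow theorem for pairs of families.  Both
    families undergo the same shifts, since only simultaneous shifting keeps
    them cross-intersecting. *)
Lemma cross_intersecting_shadow AA BB :
  cross_intersecting AA BB ->
  #|AA| <= #|shadow AA| \/ #|BB| <= #|shadow BB|.
Proof.
(* Shift as long as some shift moves a set; the total weight decreases. *)
have [m] := ubnP (weight AA + weight BB); elim: m AA BB => // m IH AA BB wm cr.
pose mv i j := [exists F in AA, moves i j AA F] || [exists F in BB, moves i j BB F].
have [|nmv] := boolP [exists i, [exists j, (rank i < rank j) && mv i j]].
  case/existsP=> i /existsP[j /andP[ij mvij]].
  have [wA eA] := weight_shift AA ij; have [wB eB] := weight_shift BB ij.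
  have w_lt : weight (shift i j AA) + weight (shift i j BB) < m.
    rewrite ltnS in wm; apply: leq_trans wm.
    case/orP: mvij => mv1.
      by rewrite mv1 in eA; rewrite -addSn leq_add // ltn_neqAle eA.
    by rewrite mv1 in eB; rewrite -addnS leq_add // ltn_neqAle eB.
  case: (IH _ _ w_lt (shift_cross_intersecting cr)); rewrite card_shift => le.
    by left; apply: leq_trans le (card_shadow_shift _ _ _).
  by right; apply: leq_trans le (card_shadow_shift _ _ _).
have nmv' i j : rank i < rank j -> ~~ mv i j.
  by move=> ij; apply: contraNN nmv => h; apply/existsP; exists i;
     apply/existsP; exists j; rewrite ij.
have shA : shifted AA.
  by apply: not_moves_shifted => i j /nmv'; rewrite negb_or => /andP[].
have [|nA] := boolP [exists A in AA, ballot A]; last first.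
  left; apply: card_shadow_not_ballot => A AAA; apply: contraNN nA => bA.
  by apply/existsP; exists A; rewrite AAA.
case/existsP=> A /andP[AAA bA]; right; apply: card_shadow_not_ballot => B BBB.
apply/negP=> bB; exact: ballot_not_cross_intersecting shA AAA BBB bA bB cr.
Qed.

End Ballot.

(** * Counting the neighbours of a uniform family *)

Section Neighbours.

Variable X : finType.
Implicit Types (F G : {set X}) (FF UU VV : {set {set X}}).

Definition covers G F : bool := [exists x, (x \notin G) && (F == x |: G)].

Lemma coversP G F :
  reflect (exists2 x, x \notin G & F = x |: G) (covers G F).
Proof.
apply: (iffP existsP) => [[x /andP[xG /eqP ->]]|[x xG ->]]; exists x => //.
by rewrite xG eqxx.
Qed.

Lemma covers_sub G F : covers G F -> G \subset F.
Proof. by case/coversP=> x _ ->; apply: subsetUr. Qed.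

Lemma card_covers G F : covers G F -> #|F| = #|G|.+1.
Proof. by case/coversP=> x xG ->; rewrite cardsU1 xG. Qed.

Lemma card_upper_covers G : #|[set F | covers G F]| = #|~: G|.
Proof.
rewrite -(@card_in_imset _ _ (fun x => x |: G) (~: G)).
  congr #|pred_of_set _|; apply/setP=> F; rewrite inE.
  by apply/coversP/imsetP => -[x xG ->]; exists x; rewrite ?inE // in xG *.
move=> x y; rewrite !inE => xG _ /setP/(_ x).
by rewrite !inE eqxx (negPf xG) !orbF => /esym/eqP.
Qed.

Lemma card_lower_covers F : #|[set G | covers G F]| = #|F|.
Proof.
rewrite -(@card_in_imset _ _ (fun x => F :\ x) F).
  congr #|pred_of_set _|; apply/setP=> G; rewrite inE.
  apply/coversP/imsetP => -[x xG ->]; exists x; rewrite ?setD1K ?setU1K //.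
  - exact: setU11.
  - by rewrite !inE eqxx.
move=> x y xF _ /= /setP/(_ x); rewrite !inE eqxx xF /=.
by rewrite andbT => /esym/negbFE/eqP.
Qed.

Definition upper_shadow FF : {set {set X}} :=
  [set F | [exists G in FF, covers G F]].

Lemma upper_shadowP FF F :
  reflect (exists2 G, G \in FF & covers G F) (F \in upper_shadow FF).
Proof. by rewrite inE; apply: exists_inP. Qed.

Lemma shadow_covers FF G :
  reflect (exists2 F, F \in FF & covers G F) (G \in shadow FF).
Proof.
apply: (iffP (shadowP _ _)) => [[x xG xF]|[F FFF /coversP[x xG eF]]].
  by exists (x |: G) => //; apply/coversP; exists x.
by exists x; rewrite -?eF.
Qed.

Lemma double_count (T U : finType) (e : T -> U -> bool)
    (A : {set T}) (B : {set U}) p :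
  (forall x, x \in A -> p <= #|[set y in B | e x y]|) ->
  p * #|A| <= \sum_(y in B) #|[set x in A | e x y]|.
Proof.
move=> hp; apply: (@leq_trans (\sum_(x in A) #|[set y in B | e x y]|)).
  by rewrite mulnC -sum_nat_const; apply: leq_sum.
rewrite (eq_bigr (fun x => \sum_(y in B | e x y) 1)) => [|x _]; last first.
  by rewrite sum1_card cardsE.
rewrite (exchange_big_dep (mem B)) /= => [|x y _ /andP[]//].
apply/eq_leq/eq_bigr => y yB; rewrite -sum1_card.
by apply: eq_bigl => x; rewrite inE yB.
Qed.

Lemma leq_card_shadow UU a : (forall F, F \in UU -> #|F| = a) ->
  a * #|UU| <= (#|X|.+1 - a) * #|shadow UU|.
Proof.
move=> Ua; apply: leq_trans (double_count (e := fun F G => covers G F) (B := shadow UU) _) _.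
  move=> F FU; rewrite -[leqLHS](Ua F FU) -card_lower_covers.
  apply/subset_leq_card/subsetP=> G GF; rewrite in_set in GF.
  by rewrite in_set GF andbT; apply/shadow_covers; exists F.
rewrite [leqRHS]mulnC -sum_nat_const; apply: leq_sum => G /shadow_covers[F FU GF].
have := card_upper_covers G; have := cardsC G; have := card_covers GF.
rewrite (Ua F FU) => -> <-; rewrite subSS addKn => <-.
by apply/subset_leq_card/subsetP=> F'; rewrite !inE => /andP[].
Qed.

(** The double count is strict because G0 covers F1, which lies outside UU: not
    all of the lower neighbours of G0 are counted. *)
Lemma ltn_card_upper_shadow UU i F0 F1 G0 :
  (forall F, F \in UU -> #|F| = i) ->
  F0 \in UU -> covers F0 G0 -> covers F1 G0 -> F1 \notin UU ->
  (#|X| - i) * #|UU| < i.+1 * #|upper_shadow UU|.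
Proof.
move=> Ui F0U F0G F1G F1U.
have G0S : G0 \in upper_shadow UU by apply/upper_shadowP; exists F0.
apply: leq_ltn_trans (double_count (e := fun F G => covers F G) (B := upper_shadow UU) _) _.
  move=> F FU; rewrite -(Ui F FU) -(cardsC F) addKn -card_upper_covers.
  apply/subset_leq_card/subsetP=> G GF; rewrite in_set in GF.
  by rewrite in_set GF andbT; apply/upper_shadowP; exists F.
rewrite [ltnRHS]mulnC -sum_nat_const (big_setD1 G0) //= [ltnRHS](big_setD1 G0) //=.
have lower F G : F \in UU -> covers F G -> #|[set F | covers F G]| = i.+1.
  by move=> FU FG; rewrite card_lower_covers (card_covers FG) (Ui F FU).
rewrite -addSn leq_add //.
  rewrite -(lower _ _ F0U F0G); apply/proper_card/properP; split.
    by apply/subsetP=> F; rewrite !inE => /andP[].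
  by exists F1; rewrite !inE // (negPf F1U).
apply: leq_sum => G /setD1P[_ /upper_shadowP[F FU FG]].
rewrite -(lower _ _ FU FG).
by apply/subset_leq_card/subsetP=> F'; rewrite !inE => /andP[].
Qed.

End Neighbours.

(** * Modifying an antichain at one of its levels *)

Section Antichains.

Variable X : finType.
Implicit Types (F G : {set X}) (FF UU VV AA BB : {set {set X}}).

Lemma leq_tmax FF F : F \in FF -> #|F| <= tmax FF.
Proof. by move=> FFF; apply: (bigmax_sup F). Qed.

Lemma tmax_leq FF m : (forall F, F \in FF -> #|F| <= m) -> tmax FF <= m.
Proof. by move=> h; apply/bigmax_leqP. Qed.

Lemma tmax_attained FF : FF != set0 -> exists2 F, F \in FF & #|F| = tmax FF.
Proof.
rewrite -card_gt0 => /(eq_bigmax_cond (fun F : {set X} => #|F|))[F FFF e].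
by exists F.
Qed.

Lemma uniform_antichain FF a : (forall F, F \in FF -> #|F| = a) -> antichain FF.
Proof.
move=> Fa F F' FFF FFF'; apply: contraNN => sFF'.
by rewrite eqEcard sFF' (Fa F FFF) (Fa F' FFF') leqnn.
Qed.

Lemma antichain_replace FF UU VV :
  antichain FF -> UU \subset FF -> antichain VV ->
  (forall F G, F \in FF :\: UU -> G \in VV ->
     ~~ (F \subset G) /\ ~~ (G \subset F)) ->
  antichain (FF :\: UU :|: VV) /\
  #|FF :\: UU :|: VV| + #|UU| = #|FF| + #|VV|.
Proof.
move=> aF UF aV inc; split.
  move=> F F' /setUP[FD|FV] /setUP[FD'|FV'] ne.
  - by apply: aF ne; [move: FD | move: FD']; case/setDP.
  - by case: (inc F F').
  - by case: (inc F' F).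
  - exact: aV.
have dis : [disjoint FF :\: UU & VV].
  rewrite disjoints_subset; apply/subsetP=> F FD; rewrite inE; apply/negP=> FV.
  by case: (inc F F FD FV); rewrite subxx.
rewrite cardsU (_ : _ :&: VV = set0) ?cards0 ?subn0; last by apply/eqP; rewrite setI_eq0.
by have := cardsID UU FF; rewrite (setIidPr UF); lia.
Qed.

Definition top_level FF : {set {set X}} := [set F in FF | #|F| == tmax FF].

Definition push_down FF : {set {set X}} :=
  FF :\: top_level FF :|: shadow (top_level FF).

Lemma top_levelP FF F :
  reflect (F \in FF /\ #|F| = tmax FF) (F \in top_level FF).
Proof. by rewrite inE; apply: (iffP andP) => -[-> /eqP]. Qed.

Lemma below_top_level FF F :
  F \in FF :\: top_level FF -> F \in FF /\ #|F| < tmax FF.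
Proof.
case/setDP=> FFF; rewrite inE FFF /= => ne; split=> //.
by rewrite ltn_neqAle ne leq_tmax.
Qed.

Lemma shadow_top_level FF G : G \in shadow (top_level FF) ->
  exists F, [/\ F \in FF, G \proper F & #|G|.+1 = tmax FF].
Proof.
case/shadow_covers=> F /top_levelP[FFF Ft] GF; exists F; split=> //.
  by rewrite properEcard covers_sub //= (card_covers GF).
by rewrite -Ft (card_covers GF).
Qed.

(** Dually to [antichain_push_up]: members of the shadow of the top level are at
    least as large as what remains, and lie strictly inside members of the
    antichain. *)
Lemma push_down_antichain FF : antichain FF ->
  antichain (push_down FF) /\
  #|push_down FF| + #|top_level FF| = #|FF| + #|shadow (top_level FF)|.
Proof.
move=> aF; apply: antichain_replace => //.
- by apply/subsetP=> F /top_levelP[].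
- apply: (@uniform_antichain _ (tmax FF).-1) => G /shadow_top_level[F [_ _ <-]].
  by [].
move=> F G /below_top_level[FFF Ft] /shadow_top_level[H [HFF GH Gt]].
have nFG : ~~ (F \subset G).
  apply/negP=> FG; have FH := sub_proper_trans FG GH.
  have := aF F H FFF HFF; rewrite (proper_neq FH) (proper_sub FH).
  by move/(_ isT).
split=> //; apply: contraNN nFG => GF.
by have /eqP-> : G == F by rewrite eqEcard GF -ltnS Gt.
Qed.

Lemma tmax_push_down FF : tmax (push_down FF) <= (tmax FF).-1.
Proof.
apply: tmax_leq => F /setUP[/below_top_level[_]|/shadow_top_level[G [_ _ <-]]] //.
by case: (tmax FF).
Qed.

Lemma push_down_cross_union s AA BB :
  cross_union s AA BB -> cross_union s (push_down AA) BB.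
Proof.
move=> cr A B /setUP[/setDP[AAA _]|/shadow_top_level[F [FAA AF _]]] BBB.
  exact: cr.
apply: leq_trans (cr F B FAA BBB); apply/subset_leq_card/setSU.
exact: proper_sub.
Qed.

(** Sets of the upper shadow have size at most that of the remaining members, so
    a comparison could only make a member of UU a proper subset of another
    member of the antichain. *)
Lemma antichain_push_up FF i :
  antichain FF -> (forall F, F \in FF -> i <= #|F|) ->
  let UU := [set F in FF | #|F| == i] in
  antichain (FF :\: UU :|: upper_shadow UU) /\
  #|FF :\: UU :|: upper_shadow UU| + #|UU| = #|FF| + #|upper_shadow UU|.
Proof.
move=> aF imin UU.
have up G : G \in upper_shadow UU ->
    exists F, [/\ F \in FF, F \proper G & #|G| = i.+1].
  case/upper_shadowP=> F; rewrite inE => /andP[FFF /eqP Fi] FG; exists F.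
  by rewrite properEcard covers_sub //= (card_covers FG) Fi ltnSn.
apply: antichain_replace => //.
- by apply/subsetP=> F; rewrite inE => /andP[].
- by apply: (@uniform_antichain _ i.+1) => G /up[F []].
move=> F G /setDP[FFF]; rewrite inE FFF /= => Fi /up[H [HFF HG Gi]].
have nGF : ~~ (G \subset F).
  apply/negP=> GF; have HF := proper_sub_trans HG GF.
  have := aF H F HFF FFF; rewrite (proper_neq HF) (proper_sub HF).
  by move/(_ isT).
split=> //; apply: contraNN nGF => FG.
by have /eqP-> : F == G by rewrite eqEcard FG Gi ltn_neqAle eq_sym Fi imin.
Qed.

(** When 2i + 1 = n the double count alone only gives that the upper shadow is at
    least as large as the level, so strictness needs a set outside the level
    obtained by one exchange from a set inside it.  There is one because
    exchanges can carry any i-set into a larger member T of the antichain,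
    while no set of the level is contained in T. *)
Lemma push_up_larger FF i :
  antichain FF -> FF != set0 ->
  (forall F, F \in FF -> i <= #|F|) -> (exists2 F, F \in FF & #|F| = i) ->
  i < tmax FF -> 2 * i < #|X| ->
  exists FF', [/\ antichain FF', #|FF| < #|FF'| & tmax FF' <= tmax FF].
Proof.
move=> aF FF0 imin [F1 F1F F1i] it iX.
have [] := antichain_push_up aF imin.
set UU := [set F in FF | #|F| == i] => aF' cF'.
have UUP F : F \in UU -> F \in FF /\ #|F| = i by rewrite inE => /andP[? /eqP].
exists (FF :\: UU :|: upper_shadow UU); split=> //; last first.
  apply: tmax_leq => F /setUP[/setDP[FFF _]|/upper_shadowP[G /UUP[_ Gi] GF]].
    exact: leq_tmax.
  by rewrite (card_covers GF) Gi.
have [T TF Tt] := tmax_attained FF0.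
have F1U : F1 \in UU by rewrite inE F1F F1i eqxx.
(* The set of the level closest to T: exchanging y for x brings it closer. *)
case: (@arg_maxnP _ F1 (mem UU) (fun F => #|F :&: T|) F1U) => F0 F0U F0max.
have {}F0U : F0 \in UU := F0U.
have [F0F F0i] := UUP F0 F0U.
have [y yF0 yT] : exists2 y, y \in F0 & y \notin T.
  apply/subsetPn; apply: aF => //; apply/eqP=> e; move: it; rewrite -Tt -e; lia.
have [x xT xF0] : exists2 x, x \in T & x \notin F0.
  apply/subsetPn/negP=> /subset_leq_card; lia.
have nyx : y != x by apply: contraNneq yT => ->.
have swapU : (x |: F0) :\ y \notin UU.
  apply/negP=> /F0max /=; rewrite leqNgt => /negP[].
  have -> : ((x |: F0) :\ y) :&: T = x |: (F0 :&: T).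
    apply/setP=> z; rewrite !inE.
    have [->|_] := eqVneq z y; last by have [->|_] := eqVneq z x; rewrite ?xT.
    by rewrite (negPf yT) !andbF (negPf nyx).
  by rewrite cardsU1 !inE (negPf xF0).
have lt : (#|X| - i) * #|UU| < i.+1 * #|upper_shadow UU|.
  apply: (@ltn_card_upper_shadow _ UU i F0 _ (x |: F0) _ F0U _ _ swapU).
  - by move=> F /UUP[].
  - by apply/coversP; exists x.
  - by apply/coversP; exists y; rewrite ?setD1K // !inE ?eqxx // yF0 orbT.
rewrite -(ltn_add2r #|UU|) cF' ltn_add2l ltnNge.
apply/negP=> le; move: lt; apply/negP.
by rewrite -leqNgt leq_mul // ltn_subRL addnn -mul2n.
Qed.

(** A set of size a has a lower neighbours, each of which has n + 1 - a upper
    neighbours, fewer than a under the hypothesis. *)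
Lemma push_down_larger FF :
  antichain FF -> FF != set0 -> #|X|.+1 < 2 * tmax FF ->
  exists FF', [/\ antichain FF', #|FF| < #|FF'| & tmax FF' <= tmax FF].
Proof.
move=> aF FF0 tX; have [aF' cF'] := push_down_antichain aF.
exists (push_down FF); split=> //; last first.
  exact: leq_trans (tmax_push_down FF) (leq_pred _).
have [T TF Tt] := tmax_attained FF0.
have T0 : 0 < #|top_level FF|.
  by rewrite card_gt0; apply/set0Pn; exists T; apply/top_levelP.
have := @leq_card_shadow _ (top_level FF) (tmax FF) (fun F h => proj2 (top_levelP _ _ h)).
suff : tmax FF * #|top_level FF| <= (#|X|.+1 - tmax FF) * #|shadow (top_level FF)| ->
       #|top_level FF| < #|shadow (top_level FF)| by move=> h /h; lia.
move=> le; rewrite ltnNge; apply/negP=> le'; move: le; apply/negP; rewrite -ltnNge.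
apply: (@leq_ltn_trans ((#|X|.+1 - tmax FF) * #|top_level FF|)).
  by rewrite leq_mul2l le' orbT.
by rewrite ltn_mul2r T0; lia.
Qed.

(** Sperner's theorem with its equality case, in the form of a single improving
    step. *)
Lemma larger_antichain FF :
  antichain FF -> FF != set0 -> FF <> layer X (tmax FF) ->
  exists FF', [/\ antichain FF', #|FF| < #|FF'| & tmax FF' <= tmax FF].
Proof.
move=> aF FF0 nl; have [T TF Tt] := tmax_attained FF0.
case: (@arg_minnP _ T (mem FF) (fun F : {set X} => #|F|) TF) => F0 F0F F0min.
have {}F0F : F0 \in FF := F0F.
have [le|it] := leqP (tmax FF) #|F0|.
  exists (layer X (tmax FF)); split.
  - by apply: (@uniform_antichain _ (tmax FF)) => F; rewrite inE => /eqP.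
  - apply: proper_card; rewrite properEneq; apply/andP; split; first exact/eqP.
    apply/subsetP=> F FFF; rewrite inE eqn_leq leq_tmax //=.
    exact: leq_trans le (F0min F FFF).
  - by apply: tmax_leq => F; rewrite inE => /eqP->.
have [iX|iX] := ltnP (2 * #|F0|) #|X|.
  by apply: push_up_larger it iX => //; exists F0.
by apply: push_down_larger => //; lia.
Qed.

Lemma full_layer_union F b s : b <= #|X| -> s < #|X| -> s < #|F| + b ->
  exists2 B : {set X}, #|B| = b & s < #|F :|: B|.
Proof.
move=> bX sX sFb.
have subs (C : {set X}) k : k <= #|C| -> exists2 B : {set X}, B \subset C & #|B| = k.
  rewrite -bin_gt0 -cards_draws card_gt0 => /set0Pn[B]; rewrite inE.
  by case/andP=> BC /eqP; exists B.
have cF := cardsC F.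
have [le|gt] := leqP b #|~: F|.
  have [B BF Bb] := subs _ _ le; exists B => //.
  by rewrite cardsU (_ : F :&: B = set0) ?cards0 ?Bb ?subn0 //;
    apply/eqP; rewrite setI_eq0 disjoint_sym disjoints_subset.
have le : #|X| - b <= #|F| by lia.
have [C CF Cb] := subs _ _ le; exists (~: C).
  by have := cardsC C; lia.
rewrite (_ : F :|: ~: C = setT) ?cardsT //; apply/setP=> x; rewrite !inE.
by have [/(subsetP CF)->|] := boolP (x \in C); rewrite ?orbT.
Qed.

End Antichains.

(** * Lowering a cross union pair *)

Section CrossUnion.

Variable X : finType.
Implicit Types AA BB : {set {set X}}.

(** Both halves of the theorem at once, symmetric in the two families and suited to
    induction: the strict inequality is the default and the two full layers the
    exception. *)
Definition dominated s AA BB : Prop :=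
  exists AA' BB', dominating_pair s AA BB AA' BB' /\
    ((AA = layer X (tmax AA) /\ BB = layer X (tmax BB)) \/
     #|AA| + #|BB| < #|AA'| + #|BB'|).

Lemma dominatedC s AA BB : dominated s AA BB -> dominated s BB AA.
Proof.
case=> AA' [BB' [[[? ?] [? ?] [? ?] [? ?] ?] h]]; exists BB', AA'.
split; first by split; rewrite // addnC.
by case: h => [[? ?]|]; [left | right; rewrite addnC [ltnRHS]addnC].
Qed.

Lemma cross_unionC s AA BB : cross_union s AA BB -> cross_union s BB AA.
Proof. by move=> cr A B AB BA; rewrite setUC cr. Qed.

Lemma dominated_tmax_le s AA BB :
  antichain AA -> antichain BB -> AA != set0 -> BB != set0 ->
  tmax AA + tmax BB <= s -> dominated s AA BB.
Proof.
have improve AA0 BB0 : antichain AA0 -> antichain BB0 -> AA0 != set0 -> BB0 != set0 ->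
    tmax AA0 + tmax BB0 <= s -> AA0 != layer X (tmax AA0) -> dominated s AA0 BB0.
  move=> aA aB A0 B0 le /eqP nl.
  have [AA' [aA' lt tA']] := larger_antichain aA A0 nl.
  exists AA', BB0; split; last by right; rewrite ltn_add2r.
  split=> //; first by rewrite -card_gt0 (leq_ltn_trans _ lt).
  - by rewrite ltnW.
  - by apply: leq_trans le; rewrite leq_add2r.
move=> aA aB A0 B0 le.
have [eA|nA] := eqVneq AA (layer X (tmax AA)); last exact: improve.
have [eB|nB] := eqVneq BB (layer X (tmax BB)).
  by exists AA, BB; split; [split | left].
by apply/dominatedC/improve; rewrite // addnC.
Qed.

(** Strictness is inherited unless BB is a full layer, and [full_layer_union]
    excludes this. *)
Lemma dominated_push_down s AA BB :
  antichain AA -> AA != set0 -> s < #|X| -> cross_union s AA BB ->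
  s < tmax AA + tmax BB -> #|top_level AA| <= #|shadow (top_level AA)| ->
  dominated s (push_down AA) BB -> dominated s AA BB.
Proof.
move=> aA A0 sX cr lt le [AA' [BB' [[n0 aAB [cA cB] [tA tB] ts] h]]].
have [_ cP] := push_down_antichain aA.
exists AA', BB'; split; last first.
  right; case: h => [[_ eB]|h]; last by lia.
  have [A AAA At] := tmax_attained A0.
  have bX : tmax BB <= #|X| by apply: tmax_leq => F _; apply: max_card.
  rewrite -At in lt; have [B Bb] := full_layer_union bX sX lt.
  by rewrite ltnNge cr // eB inE Bb.
split=> //; first by split=> //; lia.
split=> //; apply: leq_trans tA _.
exact: leq_trans (tmax_push_down AA) (leq_pred _).
Qed.

Lemma cross_union_dominated s AA BB :
  s < #|X| -> AA != set0 -> BB != set0 -> antichain AA -> antichain BB ->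
  cross_union s AA BB -> dominated s AA BB.
Proof.
move=> sX; have [m] := ubnP (tmax AA + tmax BB).
elim: m AA BB => // m IH AA BB tm A0 B0 aA aB cr.
have [|lt] := leqP (tmax AA + tmax BB) s; first exact: dominated_tmax_le.
have step AA1 BB1 : tmax AA1 + tmax BB1 < m.+1 -> AA1 != set0 -> BB1 != set0 ->
    antichain AA1 -> antichain BB1 -> cross_union s AA1 BB1 ->
    s < tmax AA1 + tmax BB1 -> #|top_level AA1| <= #|shadow (top_level AA1)| ->
    dominated s AA1 BB1.
  move=> {tm A0 B0 aA aB cr lt} tm A0 B0 aA aB cr lt le.
  have [aP cP] := push_down_antichain aA.
  have P0 : push_down AA1 != set0 by move: A0; rewrite -!card_gt0; lia.
  apply: (dominated_push_down aA A0 sX cr lt le).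
  apply: IH => //; last exact: push_down_cross_union.
  have tA : 0 < tmax AA1.
    have [A AAA At] := tmax_attained A0.
    have /set0Pn[G /shadow_top_level[F [_ _ <-]]] // : shadow (top_level AA1) != set0.
    rewrite -card_gt0; apply: leq_trans le; rewrite card_gt0.
    by apply/set0Pn; exists A; apply/top_levelP.
  have := tmax_push_down AA1; lia.
have crI : cross_intersecting (top_level AA) (top_level BB).
  move=> A B /top_levelP[AAA At] /top_levelP[BBB Bt]; apply/negP=> dAB.
  have := cr A B AAA BBB; rewrite cardsU.
  by move: dAB; rewrite -setI_eq0 => /eqP->; rewrite cards0; lia.
have [le|le] := cross_intersecting_shadow crI; first exact: step.
by apply/dominatedC/step; rewrite // 1?addnC //; apply: cross_unionC.
Qed.

End CrossUnion.

Theorem theorem1p2 (n s : nat) (X : finType) (AA BB : {set {set X}})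
    (hs : 0 < s) (hsn : s < n) (hX : #|X| = n)
    (AA0 : AA != set0) (BB0 : BB != set0)
    (antiA : antichain AA) (antiB : antichain BB)
    (crossAB : cross_union s AA BB) :
  (exists AA' BB' : {set {set X}}, dominating_pair s AA BB AA' BB') /\
  (~ (AA = layer X (tmax AA) /\ BB = layer X (tmax BB)) ->
   exists AA' BB' : {set {set X}},
     dominating_pair s AA BB AA' BB' /\ #|AA| + #|BB| < #|AA'| + #|BB'|).
Proof.
rewrite -hX in hsn.
have [AA' [BB' [dom h]]] := cross_union_dominated hsn AA0 BB0 antiA antiB crossAB.
split; first by exists AA', BB'.
by move=> nl; exists AA', BB'; case: h.
Qed.
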